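(* Let $G$ be a countable discrete amenable group, $X=\mathbb{N}^G$, and let $\phi\colon X\to\mathbb{R}$ be an exp-summable and uniformly continuous potential with finite oscillation. Then the pressure $$p(\phi)=\lim_{F\to G}\frac{1}{|F|}\log Z_F(\phi)$$ exists and $$p(\phi)=\inf_{E\in\mathcal{F}(G)}\frac{1}{|E|}\log Z_E(\phi).$$ Moreover, $p(\phi)=\sup_{A\in\mathcal{F}(\mathbb{N})}p(A,\phi)$.
   Context: $\mathbb{N}$ is the set of non-negative integers; for a set $S$, $\mathcal{F}(S)$ is the set of nonempty finite subsets of $S$. $X=\mathbb{N}^G$ has the product topology of the discrete topology; $G$ acts by $(g\cdot x)(h)=x(hg)$. For $F\in\mathcal{F}(G)$ and $w\in\mathbb{N}^F$, $[w]=\{x\in X:x_F=w\}$, with $x_F$ the restriction of $x$ to $F$, and $\phi_F(x)=\sum_{g\in F}\phi(g\cdot x)$. For $E\subseteq G$, $\delta_E(\phi)=\sup\{|\phi(x)-\phi(y)|: x_E=y_E\}$. $\phi$ has finite oscillation if $\delta_{\{1_G\}}(\phi)<\infty$. $\phi$ is uniformly continuous if for every $\epsilon>0$ there is a finite $E\subseteq G$ with $\delta_E(\phi)<\epsilon$ (equivalently, uniformly continuous for the metric $d(x,y)=2^{-\inf\{m: x_{E_m}\ne y_{E_m}\}}$, where $E_1\subseteq E_2\subseteq\cdots$ are finite sets with union $G$). $Z_F(\phi)=\sum_{w\in\mathbb{N}^F}\exp(\sup\phi_F([w]))$; $\phi$ is exp-summable if $Z_{\{1_G\}}(\phi)=\sum_{a\in\mathbb{N}}\exp(\sup\{\phi(x):x(1_G)=a\})<\infty$.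 For $A\in\mathcal{F}(\mathbb{N})$, $Z_F(A,\phi)=\sum_{w\in A^F}\exp(\sup\phi_F([w]\cap A^G))$ and $p(A,\phi)=\lim_{F\to G}\frac1{|F|}\log Z_F(A,\phi)$ (this limit exists for continuous $\phi$). $F\in\mathcal{F}(G)$ is $(K,\delta)$-invariant ($K\in\mathcal F(G)$, $\delta>0$) if $|KF\,\triangle\,F|<\delta|F|$; $G$ is amenable if $(K,\delta)$-invariant sets exist for all $K,\delta$. $\lim_{F\to G}\varphi(F)=L$ means: for every $\epsilon>0$ there are $K\in\mathcal{F}(G)$, $\delta>0$ such that $|\varphi(F)-L|<\epsilon$ for every $(K,\delta)$-invariant $F\in\mathcal{F}(G)$. *)

(* Defs.v *)
From HB Require Import structures.
From mathcomp Require Import all_boot all_order all_algebra finmap.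
From mathcomp Require Import all_classical all_reals all_analysis.

Set Implicit Arguments.
Unset Strict Implicit.
Unset Printing Implicit Defensive.

Import Order.TTheory GRing.Theory Num.Theory.

Local Open Scope classical_set_scope.
Local Open Scope fset_scope.
Local Open Scope ring_scope.

Section FolnerLimit.
Variables (R : realType) (G : groupType).

Definition fset_mulg (K F : {fset G}) : {fset G} :=
  [fset (k * f)%g | k in K, f in F].

Definition fset_symdiff (A B : {fset G}) : {fset G} :=
  (A `\` B) `|` (B `\` A).

Definition invariant_fset (K : {fset G}) (d : R) (F : {fset G}) : Prop :=
  (#|` fset_symdiff (fset_mulg K F) F|)%:R < d * (#|` F|)%:R.

Definition amenable : Prop :=
  forall (K : {fset G}) (d : R), K != fset0 -> 0 < d ->
    exists2 F : {fset G}, F != fset0 & invariant_fset K d F.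

(* [F --> folner R G] renders lim_{F -> G}: a property holds near [folner] iff
   it holds for all nonempty (K, d)-invariant F, for some nonempty K, d > 0. *)
Definition folner : set_system {fset G} :=
  filter_from [set Kd : {fset G} * R | Kd.1 != fset0 /\ 0 < Kd.2]
    (fun Kd => [set F : {fset G} | F != fset0 /\ invariant_fset Kd.1 Kd.2 F]).

Lemma invariant_fsetS (K K' F : {fset G}) (d : R) : K' != fset0 ->
  K' `<=` K -> invariant_fset K (d / 2) F -> invariant_fset K' d F.
Proof.
move=> /fset0Pn[k kK'] K'K; rewrite /invariant_fset => KF.
have FK : (#|` F| <= #|` fset_mulg K' F|)%N.
  have inj : {in F &, injective (fun f => (k * f)%g)} by move=> x y _ _ /mulgI.
  rewrite -(card_in_imfset imfset_key inj).
  apply: fsubset_leq_card; apply/fsubsetP => x /imfsetP[f /= fF ->].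
  exact: in_imfset2.
have K'FK : fset_mulg K' F `<=` fset_mulg K F.
  apply/fsubsetP => x /imfset2P[a /= aK' [f /= fF ->]].
  by apply: in_imfset2 => //=; apply: (fsubsetP K'K).
have card_sd A B : #|` fset_symdiff A B| = (#|` A `\` B| + #|` B `\` A|)%N.
  apply/eqP; rewrite cardfsU.
  suff -> : (A `\` B) `&` (B `\` A) = fset0 by rewrite cardfs0 subn0.
  by apply/fsetP => x; rewrite !inE; case: (x \in A); case: (x \in B).
have FD : (#|` F `\` fset_mulg K' F| <= #|` fset_mulg K' F `\` F|)%N.
  by rewrite !cardfsD fsetIC leq_sub2r.
have le2 : (#|` fset_symdiff (fset_mulg K' F) F|
            <= (#|` fset_symdiff (fset_mulg K F) F|).*2)%N.
  rewrite !card_sd -addnn.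
  have leD : (#|` fset_mulg K' F `\` F| <= #|` fset_mulg K F `\` F|)%N.
    exact/fsubset_leq_card/fsetSD.
  apply: leq_add; [apply: (leq_trans leD)|apply: leq_trans FD (leq_trans leD _)];
    exact: leq_addr.
rewrite -(ler_nat R) -muln2 natrM in le2.
apply: le_lt_trans le2 _.
by rewrite -ltr_pdivlMr// mulrAC.
Qed.

#[global] Instance folner_filter : Filter folner.
Proof.
apply: filter_from_filter.
  by exists ([fset 1%g], 1); split => //=; apply/fset0Pn; exists 1%g; rewrite inE.
move=> [K d] [K' d'] /= [K0 d0] [K'0 d'0].
exists (K `|` K', Num.min d d' / 2) => /=.
  split; last by rewrite divr_gt0// lt_min d0.
  by rewrite fsetU_eq0 negb_and K0.
move=> F /= [F0 inv]; have cF : 0 <= (#|` F|)%:R :> R by rewrite ler0n.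
have le (K1 : {fset G}) d1 : K1 != fset0 -> K1 `<=` K `|` K' ->
    Num.min d d' <= d1 -> invariant_fset K1 d1 F.
  move=> K10 K1K d1d; apply: (invariant_fsetS K10 K1K).
  apply: lt_le_trans inv _; rewrite ler_wpM2r// ler_wpM2r//.
by split; split=> //; apply: le; rewrite ?fsubsetUl ?fsubsetUr ?ge_min ?lexx ?orbT.
Qed.

Lemma folner_proper : amenable -> ProperFilter folner.
Proof.
move=> amG; apply: filter_from_proper.
by move=> [K d] /= [K0 d0]; have [F F0 inv] := amG K d K0 d0; exists F.
Qed.

End FolnerLimit.

Arguments folner : clear implicits.
Arguments amenable : clear implicits.

Section Potential.
Variables (R : realType) (G : groupType).

Definition config : Type := G -> nat.

Implicit Types (phi : config -> R) (F : {fset G}) (A : {fset nat}).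

Definition act (g : G) (x : config) : config := fun h => x (h * g)%g.

Definition restr F (x : config) : {ffun F -> nat} := [ffun g => x (fsval g)].

Definition cyl F (w : {ffun F -> nat}) : set config :=
  [set x | restr F x = w].

Definition orbit_sum phi F (x : config) : R := \sum_(g <- F) phi (act g x).

Definition osc (E : set G) phi : \bar R :=
  ereal_sup [set r | exists x y : config,
    (forall g, E g -> x g = y g) /\ r = (`|phi x - phi y|)%:E].

Definition finite_oscillation phi : Prop := (osc [set 1%g] phi < +oo)%E.

Definition uniformly_continuous phi : Prop :=
  forall e : R, 0 < e -> exists E : {fset G}, (osc [set` E] phi < e%:E)%E.

(* All summands are nonnegative, so [esum] is the sum over all of N^F, with
   value [+oo] when it diverges (or when some supremum is [+oo]). *)
Definition Zpart phi F : \bar R :=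
  \esum_(w in [set: {ffun F -> nat}])
    expeR (ereal_sup [set (orbit_sum phi F x)%:E | x in cyl w]).

Definition exp_summable phi : Prop := (Zpart phi [fset 1%g] < +oo)%E.

Definition full_shift A : set config := [set x | forall g, x g \in A].

Definition Zpart_on A phi F : \bar R :=
  \esum_(w in [set w : {ffun F -> nat} | forall g, w g \in A])
    expeR (ereal_sup
      [set (orbit_sum phi F x)%:E | x in cyl w `&` full_shift A]).

(* (log z) / |F| in [\bar R], with log [+oo] = [+oo]; used for nonempty F. *)
Definition mean_log (F : {fset G}) (z : \bar R) : \bar R :=
  (((#|` F|)%:R^-1)%:E * lne z)%E.

Definition pressure phi : \bar R :=
  lim (mean_log F (Zpart phi F) @[F --> folner R G]).

Definition pressure_on A phi : \bar R :=
  lim (mean_log F (Zpart_on A phi F) @[F --> folner R G]).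

End Potential.

(* Main.v *)
(* The upper bound on [log Z_F] comes from Finner's inequality for counting
   measure. The translates [E g] contained in [F], each of weight [1 / |E|], and
   singletons of the missing weight form a fractional cover of [F], so
   [log Z_F <= n (log Z_E / |E|) + (|F| - n) log Z_1] where [n] counts the [g]
   in [F] with [E g] contained in [F]. As [n / |F|] tends to 1, the limit exists
   and equals the infimum, with no tilings involved. The same holds for the
   configurations over any alphabet [A].

   For the last identity, replace every symbol outside a finite [A] by a fixed
   [a0] in [A]. Uniform continuity and finite oscillation bound the change of
   [phi_F] by [eps |F|], a boundary term, and a cost per replaced site, so that
   [Z_F(phi) <= exp (2 eps |F| + o(|F|)) Z_F(A, phi)] once the tail of the
   one-site partition function outside [A] is small enough. *)

Require Import Defs.
From HB Require Import structures.
From mathcomp Require Import all_boot all_order all_algebra finmap.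
From mathcomp Require Import all_classical all_reals all_analysis.
From mathcomp Require Import ring lra.

Set Implicit Arguments.
Unset Strict Implicit.
Unset Printing Implicit Defensive.

Import Order.TTheory GRing.Theory Num.Theory.

Local Open Scope classical_set_scope.
Local Open Scope fset_scope.
Local Open Scope ring_scope.

(** * Finner's inequality *)

Section Words.
Variables (R : realType) (I : choiceType).
Implicit Types (B : seq nat) (s : seq I) (x y : I -> nat) (u : (I -> nat) -> R).

Definition upd x (j : I) (a : nat) : I -> nat :=
  fun h => if h == j then a else x h.

(* Words over the sites [s] are encoded as the configurations extending them by
   [x], so that the site set does not occur in a type. *)
Fixpoint words B s x : seq (I -> nat) :=
  if s is j :: s' then flatten [seq words B s' (upd x j a) | a <- B]
  else [:: x].

Lemma mem_words B s x y : uniq s ->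
  reflect ((forall j, j \in s -> y j \in B) /\
           (forall j, j \notin s -> y j = x j)) (y \in words B s x).
Proof.
elim: s x => [|j s IH] x /=.
  move=> _; rewrite inE; apply: (iffP eqP) => [-> //|[_ yx]].
  by apply/funext => h; apply: yx.
move=> /andP[js us]; apply: (iffP flatten_mapP) => [[a aB /(IH _ us)[yB yx]]|[yB yx]].
  have yj : y j = a by rewrite yx// /upd eqxx.
  split => h; rewrite inE; first by case/orP => [/eqP->|/yB //]; rewrite yj.
  by rewrite negb_or => /andP[/negbTE hj hs]; rewrite yx// /upd hj.
exists (y j); first by apply: yB; rewrite inE eqxx.
apply/(IH _ us); split => h hs; first by apply: yB; rewrite inE hs orbT.
rewrite /upd; case: eqVneq => [-> //|hj].
by apply: yx; rewrite inE negb_or hj.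
Qed.

Lemma words_restr B s x y : uniq s -> y \in words B s x ->
  forall j, j \notin s -> y j = x j.
Proof. by move=> us /(mem_words _ _ _ us)[]. Qed.

Lemma uniq_words B s x : uniq B -> uniq s -> uniq (words B s x).
Proof.
move=> uB; elim: s x => //= j s IH x /andP[js us].
(* The outer letters run over a list [C] of their own, so that the induction shortens [C] while the
   inner words keep the alphabet [B]. *)
have gen C : uniq C -> uniq (flatten [seq words B s (upd x j a) | a <- C]).
  elim: C => //= a C IHC /andP[aC uC]; rewrite cat_uniq IH// IHC// andbT.
  apply/hasPn => y /flatten_mapP[b bC yb]; apply/negP => ya.
  have := words_restr us ya js; rewrite (words_restr us yb js) /upd eqxx => ba.
  by rewrite -ba bC in aC.
exact: gen.
Qed.

Lemma perm_words B s t x : uniq B -> uniq s -> perm_eq s t ->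
  perm_eq (words B s x) (words B t x).
Proof.
move=> uB us st; have ut : uniq t by rewrite -(perm_uniq st).
apply: uniq_perm; rewrite ?uniq_words// => y.
by apply/(mem_words _ _ _ us)/(mem_words _ _ _ ut) => -[yB yx]; split=> j;
  move: (yB j) (yx j); rewrite (perm_mem st).
Qed.

(** Log-sum-exp over the sites [s]. Sites are summed out one at a time ([lse_cons]), which drives
    the induction in Finner's inequality. *)
Definition lse B s u x : R := ln (\sum_(y <- words B s x) expR (u y)).

Lemma sum_expR_gt0 (T : eqType) (r : seq T) (f : T -> R) : r != [::] ->
  0 < \sum_(z <- r) expR (f z).
Proof.
case: r => // z r _; rewrite big_cons ltr_pwDl ?expR_gt0//.
by apply: sumr_ge0 => *; apply: expR_ge0.
Qed.

Lemma words_neq0 B s x : B != [::] -> words B s x != [::].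
Proof.
case: B => // a B _; elim: s x => //= j s IH x.
by case: (words _ _ _) (IH (upd x j a)).
Qed.

Lemma lseK B s u x : B != [::] ->
  expR (lse B s u x) = \sum_(y <- words B s x) expR (u y).
Proof. by move=> B0; rewrite lnK// posrE sum_expR_gt0// words_neq0. Qed.

Lemma lse_nil B u x : lse B [::] u x = u x.
Proof. by rewrite /lse/= big_seq1 expRK. Qed.

Lemma lse_cons B j s u x : B != [::] ->
  lse B (j :: s) u x = ln (\sum_(a <- B) expR (lse B s u (upd x j a))).
Proof.
move=> B0; rewrite {1}/lse/= big_flatten big_map; congr ln.
by apply: eq_bigr => a _; rewrite lseK.
Qed.

Lemma le_ln_sum_expR (T : eqType) (r : seq T) (f g : T -> R) : r != [::] ->
  (forall z, z \in r -> f z <= g z) ->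
  ln (\sum_(z <- r) expR (f z)) <= ln (\sum_(z <- r) expR (g z)).
Proof.
move=> r0 fg; rewrite ler_ln ?posrE ?sum_expR_gt0//.
by rewrite big_seq [leRHS]big_seq ler_sum// => z zr; rewrite ler_expR fg.
Qed.

Lemma lse_le B s u v x : B != [::] ->
  (forall y, y \in words B s x -> u y <= v y) -> lse B s u x <= lse B s v x.
Proof. by move=> B0; apply: le_ln_sum_expR; apply: words_neq0. Qed.

Lemma lse_perm B s t u x : uniq B -> uniq s -> perm_eq s t ->
  lse B s u x = lse B t u x.
Proof. by move=> uB us st; rewrite /lse (perm_big _ (perm_words x uB us st)). Qed.

Definition depends_on (P : pred I) u :=
  forall x y, (forall j, P j -> x j = y j) -> u x = u y.

Lemma lse_depends_on B s P u : B != [::] -> depends_on P u ->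
  depends_on P (lse B s u).
Proof.
move=> B0 uP; elim: s => [|j s IH] x y xy; first by rewrite !lse_nil; exact: uP.
rewrite !lse_cons//; congr ln; apply: eq_bigr => a _; congr expR.
by apply: IH => h Ph; rewrite /upd; case: eqP => // _; apply: xy.
Qed.

(** The tangent to exp at the weighted mean [m] lies below exp, and its weighted average is exactly
    [expR m]. *)
Lemma expR_jensen (J : Type) (r : seq J) (P : pred J) (lam v : J -> R) :
  (forall i, P i -> 0 <= lam i) -> \sum_(i <- r | P i) lam i = 1 ->
  expR (\sum_(i <- r | P i) lam i * v i)
    <= \sum_(i <- r | P i) lam i * expR (v i).
Proof.
move=> lam0 lam1; set m := \sum_(i <- r | P i) _.
have -> : expR m = \sum_(i <- r | P i) lam i * (expR m * (1 + (v i - m))).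
  transitivity (expR m * (1 * (1 - m) + m)); first by ring.
  rewrite -{1}lam1 {3}/m mulr_suml -big_split/= mulr_sumr.
  by apply: eq_bigr => i _; ring.
apply: ler_sum => i Pi; rewrite ler_wpM2l ?lam0//.
have -> : expR (v i) = expR m * expR (v i - m) by rewrite -expRD; congr expR; ring.
by rewrite ler_wpM2l ?expR_ge0// expR_ge1Dx.
Qed.

(** Hölder's inequality in logarithmic form. Subtracting from each [v i] its own log-sum [L i] makes
    the exponentials sum to 1 over [B]; Jensen's inequality is then applied letter by letter. *)
Lemma ln_sum_expR_convex (J : Type) (T : eqType) (r : seq J) (P : pred J)
    (lam : J -> R) (B : seq T) (v : J -> T -> R) : B != [::] ->
  (forall i, P i -> 0 <= lam i) -> \sum_(i <- r | P i) lam i = 1 ->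
  ln (\sum_(a <- B) expR (\sum_(i <- r | P i) lam i * v i a))
    <= \sum_(i <- r | P i) lam i * ln (\sum_(a <- B) expR (v i a)).
Proof.
move=> B0 lam0 lam1; set L := fun i => ln (\sum_(a <- B) expR (v i a)).
set M := \sum_(i <- r | P i) _.
rewrite -[M]expRK ler_ln ?posrE ?expR_gt0 ?sum_expR_gt0//.
apply: (@le_trans _ _ (\sum_(a <- B) expR M *
    \sum_(i <- r | P i) lam i * expR (v i a - L i))).
  apply: ler_sum => a _.
  have -> : \sum_(i <- r | P i) lam i * v i a
      = M + \sum_(i <- r | P i) lam i * (v i a - L i).
    by rewrite -big_split/=; apply: eq_bigr => i _; rewrite -/(L i); ring.
  by rewrite expRD ler_wpM2l ?expR_ge0// expR_jensen.
rewrite -mulr_sumr exchange_big/= -{2}[expR M]mulr1 ler_wpM2l ?expR_ge0//.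
rewrite -lam1; apply: ler_sum => i Pi; rewrite -mulr_sumr.
have -> : \sum_(a <- B) expR (v i a - L i) = 1; last by rewrite mulr1.
under eq_bigr do rewrite expRB.
by rewrite -mulr_suml /L lnK ?posrE ?sum_expR_gt0// divff// gt_eqF// sum_expR_gt0.
Qed.

(* Finner's inequality for counting measure, in logarithmic form. *)
Lemma lse_fractional_cover B s (J : Type) (r : seq J) (lam : J -> R)
    (P : J -> pred I) (u : J -> (I -> nat) -> R) x : B != [::] ->
  (forall i, 0 <= lam i) -> (forall i, depends_on (P i) (u i)) ->
  (forall j, j \in s -> \sum_(i <- r | P i j) lam i = 1) ->
  lse B s (fun y => \sum_(i <- r) lam i * u i y) x
    <= \sum_(i <- r) lam i * lse B [seq k <- s | P i k] (u i) x.
Proof.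
move=> B0 lam0 uP; elim: s x => [|j s IH] x cov.
  by rewrite lse_nil; under [leRHS]eq_bigr do rewrite lse_nil.
have {}IH y : lse B s (fun y => \sum_(i <- r) lam i * u i y) y
    <= \sum_(i <- r) lam i * lse B [seq k <- s | P i k] (u i) y.
  by apply: IH => k ks; apply: cov; rewrite inE ks orbT.
rewrite lse_cons//; apply: le_trans (le_ln_sum_expR B0 (fun a _ => IH _)) _.
(* Sum out the site [j]. Terms with [j] outside [P i] do not see the letter there and form the
   constant [c]; the others have total weight 1, so Hölder's inequality applies to them. *)
pose c := \sum_(i <- r | ~~ P i j) lam i * lse B [seq k <- s | P i k] (u i) x.
pose v i a := lse B [seq k <- s | P i k] (u i) (upd x j a).
have split_sum a : \sum_(i <- r) lam i * v i a
    = c + \sum_(i <- r | P i j) lam i * v i a.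
  rewrite (bigID (fun i => P i j))/= addrC; congr (_ + _).
  apply: eq_bigr => i Pij; congr (_ * _); rewrite /v; apply: (lse_depends_on _ B0 (uP i)).
  by move=> h Ph; rewrite /upd; case: eqP => // hj; rewrite -hj Ph in Pij.
under eq_bigr do rewrite split_sum expRD.
rewrite -mulr_sumr lnM ?posrE ?expR_gt0 ?sum_expR_gt0// expRK.
rewrite [leRHS](bigID (fun i => P i j))/= addrC; apply: lerD.
  by apply: ler_sum => i /negbTE Pij; rewrite Pij.
have cov1 : \sum_(i <- r | P i j) lam i = 1 by apply: cov; rewrite inE eqxx.
apply: le_trans (ln_sum_expR_convex v B0 (fun i _ => lam0 i) cov1) _.
by apply: ler_sum => i Pij; rewrite Pij lse_cons.
Qed.

End Words.

(** * Collapsing the letters outside a finite alphabet *)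

Section Retract.
Variables (R : realType) (I : choiceType) (A : seq nat) (a0 : nat).

Definition retract (y : I -> nat) : I -> nat :=
  fun j => if y j \in A then y j else a0.

Lemma retract_upd x j a :
  retract (upd x j a) = upd (retract x) j (if a \in A then a else a0).
Proof. by apply/funext => h; rewrite /retract /upd; case: eqP. Qed.

(** Site by site: a letter of [A] contributes its own term, while the letters outside [A] all turn
    into [a0] and together weigh at most [eta] times the term of [a0], hence at most [eta] times the
    sum over [A]. Each site costs a factor [1 + eta]. *)
Lemma sum_words_retract_le (D : seq nat) (t : nat -> R) (eta : R)
    (V : (I -> nat) -> R) s x :
  uniq A -> uniq D -> {subset A <= D} -> a0 \in A -> uniq s ->
  (forall a, 0 <= t a) -> (forall a, a \in A -> t a = 1) ->
  \sum_(a <- D | a \notin A) t a <= eta -> (forall y, 0 <= V y) ->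
  \sum_(y <- words D s x) V (retract y) * \prod_(j <- s) t (y j)
    <= (1 + eta) ^+ size s * \sum_(y <- words A s (retract x)) V y.
Proof.
move=> uA uD AD a0A us t0 t1 teta V0.
have eta0 : 0 <= eta by apply: le_trans teta; apply: sumr_ge0.
elim: s us x => [_|j s IH] /= => [x|/andP[js us] x].
  by rewrite !big_seq1 big_nil mulr1 expr0 mul1r.
rewrite !big_flatten !big_map.
pose Q b := \sum_(y <- words A s (upd (retract x) j b)) V y.
have Q0 b : 0 <= Q b by apply: sumr_ge0.
apply: (@le_trans _ _ (\sum_(a <- D)
    t a * ((1 + eta) ^+ size s * Q (if a \in A then a else a0)))).
  apply: ler_sum => a _; rewrite /Q -retract_upd.
  apply: le_trans (ler_wpM2l (t0 a) (IH us _)).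
  rewrite mulr_sumr big_seq [leRHS]big_seq; apply: ler_sum => y yw.
  rewrite big_cons (words_restr us yw js) /upd eqxx.
  by rewrite mulrCA.
rewrite (eq_bigr (fun a => (1 + eta) ^+ size s
  * (t a * Q (if a \in A then a else a0)))); last by move=> a _; rewrite mulrCA.
rewrite -mulr_sumr exprSr -mulrA ler_wpM2l ?exprn_ge0 ?addr_ge0//.
rewrite (bigID (mem A))/= mulrDl mul1r; apply: lerD.
  rewrite -big_filter (perm_big A)/=; last first.
    apply: uniq_perm; rewrite ?filter_uniq// => a; rewrite mem_filter andbC.
    by case: (boolP (a \in A)) => [/AD->|]; rewrite ?andbF.
  rewrite big_seq [leRHS]big_seq; apply: ler_sum => a aA.
  by rewrite aA t1// mul1r.
apply: (@le_trans _ _ (eta * Q a0)).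
  rewrite (eq_bigr (fun a => t a * Q a0)); last by move=> a /negbTE ->.
  by rewrite -mulr_suml ler_wpM2r.
rewrite ler_wpM2l//.
rewrite (perm_big _ (perm_to_rem a0A)) big_cons/= lerDl.
by apply: sumr_ge0 => b _; apply: Q0.
Qed.

End Retract.

Lemma sumr_const_seq (R : pzSemiRingType) (T : Type) (s : seq T) (c : R) :
  \sum_(i <- s) c = (size s)%:R * c.
Proof. by rewrite big_const_seq count_predT iter_addr_0 mulr_natl. Qed.

(** * Orbit sums and their suprema over cylinders, for an arbitrary alphabet *)

Section Local.
Variables (R : realType) (G : groupType) (phi : config G -> R) (A : set nat).
Implicit Types (B : seq nat) (s : seq G) (x y : config G).

Definition orb s y : R := \sum_(g <- s) phi (act g y).

Definition in_shift : set (config G) := [set x | forall g, A (x g)].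

(** A real supremum: under the oscillation bound the set is bounded above ([orb_set_ub]), and it
    contains [orb s x] when [x] lies in the shift. *)
Definition orb_sup s x : R :=
  sup [set orb s y | y in [set y | (forall g, g \in s -> y g = x g)
                                   /\ in_shift y]].

Lemma act1 x : act 1%g x = x.
Proof. by apply/funext => h; rewrite /act mulg1. Qed.

Lemma actM g h x : act (g * h)%g x = act g (act h x).
Proof. by apply/funext => k; rewrite /act mulgA. Qed.

Lemma in_shift_words B s x y : uniq s -> (forall a, a \in B -> A a) ->
  in_shift x -> y \in words B s x -> in_shift y.
Proof.
move=> us BA xA /(mem_words _ _ _ us)[yB yx] g.
by have [/yB/BA//|/yx ->] := boolP (g \in s).
Qed.

Variable O : R.
Hypothesis phiO : forall x y, x 1%g = y 1%g -> `|phi x - phi y| <= O.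

(** The value of [act g x] at the identity is [x g], so each summand changes by at most one
    oscillation [O]. *)
Lemma orb_osc s x y : (forall g, g \in s -> y g = x g) ->
  orb s y <= orb s x + (size s)%:R * O.
Proof.
move=> xy; rewrite -sumr_const_seq -big_split/= /orb.
rewrite big_seq [leRHS]big_seq; apply: ler_sum => g gs.
rewrite -lerBlDl; apply: le_trans (ler_norm _) _; apply: phiO.
by rewrite /act mul1g xy.
Qed.

Lemma orb_set_ub s x : has_ubound [set orb s y | y in
  [set y | (forall g, g \in s -> y g = x g) /\ in_shift y]].
Proof.
exists (orb s x + (size s)%:R * O) => _ [y [yx _] <-].
exact: orb_osc.
Qed.

Lemma le_orb_sup s x y : in_shift y -> (forall g, g \in s -> y g = x g) ->
  orb s y <= orb_sup s x.
Proof. by move=> yA yx; apply: ub_le_sup; [exact: orb_set_ub|exists y]. Qed.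

Lemma orb_sup_le s x (M : R) : in_shift x ->
  (forall y, in_shift y -> (forall g, g \in s -> y g = x g) -> orb s y <= M) ->
  orb_sup s x <= M.
Proof.
move=> xA H; apply: ge_sup; first by exists (orb s x), x.
by move=> _ [y [yx yA] <-]; apply: H.
Qed.

Lemma orb_sup_depends_on s : depends_on (mem s) (orb_sup s).
Proof.
move=> x y xy; congr sup; congr image; apply/seteqP.
by split=> z [zx zA]; split=> // g gs; rewrite zx// xy.
Qed.

(* [log Z_F(A, phi)] with the sum restricted to words over the finite [B]. *)
Definition lnW B s x := lse B s (orb_sup s) x.

Lemma orb_translate s g y : orb [seq (h * g)%g | h <- s] y = orb s (act g y).
Proof. by rewrite /orb big_map; apply: eq_bigr => h _; rewrite actM. Qed.

Lemma in_shift_act g x : in_shift x -> in_shift (act g x).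
Proof. by move=> xA h; apply: xA. Qed.

Lemma orb_sup_translate s g x : in_shift x ->
  orb_sup [seq (h * g)%g | h <- s] x <= orb_sup s (act g x).
Proof.
move=> xA; apply: orb_sup_le => // y yA yx; rewrite orb_translate.
apply: le_orb_sup; first exact: in_shift_act.
by move=> h hs; rewrite /act yx//; apply/mapP; exists h.
Qed.

Lemma words_translate B s g x :
  [seq act g y | y <- words B [seq (h * g)%g | h <- s] x] = words B s (act g x).
Proof.
elim: s x => //= h s IH x; rewrite map_flatten -map_comp; congr flatten.
apply: eq_map => a /=; rewrite IH; congr words; apply/funext => k.
by rewrite /act /upd (inj_eq (@mulIg _ g)).
Qed.

Lemma uniq_translate s g : uniq [seq (h * g)%g | h <- s] = uniq s.
Proof. by rewrite map_inj_uniq//; apply: mulIg. Qed.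

(** Right translation of the sites is absorbed by [act g], which preserves the shift. Bounds that
    are uniform in the configuration therefore carry over from [E] to every tile [E g]. *)
Lemma lnW_translate B s g x : B != [::] -> (forall a, a \in B -> A a) ->
  uniq s -> in_shift x ->
  lnW B [seq (h * g)%g | h <- s] x <= lnW B s (act g x).
Proof.
move=> B0 BA us xA; rewrite /lnW /lse -words_translate big_map.
apply: le_ln_sum_expR; first exact: words_neq0.
move=> y yw; apply: orb_sup_translate.
by apply: in_shift_words yw => //; rewrite uniq_translate.
Qed.

(** As the weights at every site of [F] sum to 1, the orbit sum over [F] is the weighted sum of
    those over the [e i]. Taking the suprema separately only increases the right-hand side, and
    Finner's inequality applies. *)
Lemma lnW_fractional_cover B (F : seq G) (J : eqType) (r : seq J) (lam : J -> R)
    (e : J -> seq G) x : B != [::] -> uniq B -> (forall a, a \in B -> A a) ->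
  uniq F -> in_shift x ->
  (forall i, 0 <= lam i) -> (forall i, uniq (e i)) ->
  (forall j, j \in F -> \sum_(i <- r | j \in e i) lam i = 1) ->
  (forall i, i \in r -> {subset e i <= F}) ->
  lnW B F x <= \sum_(i <- r) lam i * lnW B (e i) x.
Proof.
move=> B0 uB BA uF xA lam0 ue cov eF.
have pF i : i \in r -> perm_eq [seq k <- F | k \in e i] (e i).
  move=> ir; apply: uniq_perm; rewrite ?filter_uniq// => k; rewrite mem_filter.
  by apply: andb_idr; exact: eF.
have sub y : in_shift y -> orb_sup F y <= \sum_(i <- r) lam i * orb_sup (e i) y.
  move=> yA; apply: orb_sup_le => // z zA zy.
  have -> : orb F z = \sum_(i <- r) lam i * orb (e i) z.
    transitivity (\sum_(i <- r) \sum_(f <- F | f \in e i) lam i * phi (act f z)).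
      rewrite (exchange_big_dep xpredT)//= /orb big_seq [RHS]big_seq.
      by apply: eq_bigr => f fF; rewrite -mulr_suml cov// mul1r.
    rewrite big_seq [RHS]big_seq; apply: eq_bigr => i ir.
    by rewrite -mulr_sumr -big_filter /orb (perm_big _ (pF i ir)).
  rewrite big_seq [leRHS]big_seq; apply: ler_sum => i ir.
  by rewrite ler_wpM2l// le_orb_sup// => g /(eF _ ir); apply: zy.
apply: (@le_trans _ _
    (lse B F (fun y => \sum_(i <- r) lam i * orb_sup (e i) y) x)).
  by apply: lse_le => // y yw; apply: sub; apply: in_shift_words yw.
apply: le_trans (lse_fractional_cover (P := fun i => mem (e i)) x B0 lam0 _ cov) _.
  by move=> i; apply: orb_sup_depends_on.
rewrite big_seq [leRHS]big_seq; apply: ler_sum => i ir.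
by rewrite ler_wpM2l// (lse_perm _ _ uB _ (pF i ir)) ?filter_uniq.
Qed.

(** * Fractional covers by tiles and singletons *)

Definition tile_centers (E F : seq G) := [seq g <- F | all (fun e => (e * g)%g \in F) E].

(** A site [g] of [F] that is not a centre has some [e * g] outside [F], hence in [D], and [g] is
    recovered from [e] and [e * g]. *)
Lemma size_non_centers (E F D : seq G) : uniq F ->
  (forall e g, e \in E -> g \in F -> (e * g)%g \notin F -> (e * g)%g \in D) ->
  (size F - size (tile_centers E F) <= size E * size D)%N.
Proof.
move=> uF EFD; set p := fun g => all (fun e => (e * g)%g \in F) E.
rewrite leq_subLR -(count_predC p F) -size_filter leq_add2l -size_filter.
rewrite -(size_allpairs (fun e d => (e^-1 * d)%g)).
apply: uniq_leq_size; first by rewrite filter_uniq.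
move=> g; rewrite mem_filter => /andP[/= /allPn[e eE eg] gF].
by apply/allpairsP; exists (e, (e * g)%g); rewrite /= mulKg; split => //; apply: EFD.
Qed.

Section Cover.
Variables (B : seq nat) (x : config G).
Hypotheses (B0 : B != [::]) (uB : uniq B) (BA : forall a, a \in B -> A a).
Hypothesis xA : in_shift x.

Lemma lnW_site z1 f : (forall y, in_shift y -> lnW B [:: 1%g] y <= z1) ->
  lnW B [:: f] x <= z1.
Proof.
move=> W1; have := @lnW_translate B [:: 1%g] f x B0 BA isT xA.
by rewrite /= mul1g => /le_trans; apply; apply/W1/in_shift_act.
Qed.

(** The cover by singletons of weight 1. It later makes every partition function finite once the
    one-site one is. *)
Lemma lnW_le_sites (F : seq G) z1 : uniq F ->
  (forall y, in_shift y -> lnW B [:: 1%g] y <= z1) ->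
  lnW B F x <= (size F)%:R * z1.
Proof.
move=> uF W1; rewrite -sumr_const_seq.
apply: (@le_trans _ _ (\sum_(f <- F) 1 * lnW B [:: f] x)); last first.
  by apply: ler_sum => f _; rewrite mul1r lnW_site.
apply: lnW_fractional_cover => // [j jF|f fF k]; last by rewrite inE => /eqP->.
rewrite (eq_bigl (pred1 j)) => [|f]; last by rewrite inE eq_sym.
by rewrite -big_filter filter_pred1_uniq// big_seq1.
Qed.

(* Tiles [E g] inside [F], each of weight [1 / |E|], cover every site at most
   once; singletons make up the missing weight. *)
Lemma lnW_le_tiles (E F : seq G) zE z1 : E != [::] -> uniq E -> uniq F ->
  (forall y, in_shift y -> lnW B E y <= zE) ->
  (forall y, in_shift y -> lnW B [:: 1%g] y <= z1) ->
  lnW B F x <= (size (tile_centers E F))%:R * (zE / (size E)%:R)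
    + ((size F)%:R - (size (tile_centers E F))%:R) * z1.
Proof.
move=> E0 uE uF WE W1; set J := tile_centers E F.
have cE : 0 < (size E)%:R :> R by rewrite ltr0n lt0n size_eq0.
pose tile g := [seq (e * g)%g | e <- E].
(* [n f] counts the tiles through [f]. In [G + G] the left copy indexes tiles by their centres, the
   right copy indexes singletons. *)
pose n f := size [seq g <- J | f \in tile g].
pose lam (i : G + G) : R :=
  if i is inr f then 1 - (n f)%:R / (size E)%:R else (size E)%:R^-1.
pose e (i : G + G) := match i with inl g => tile g | inr f => [:: f] end.
pose r : seq (G + G)%type := map inl J ++ map inr F.
have uJ : uniq J by rewrite filter_uniq.
(* The centre of a tile through [f] has the form [e^-1 * f] with [e] in [E]; hence the singleton
   weights are nonnegative. *)
have nE f : (n f <= size E)%N.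
  rewrite -(size_map (fun e => (e^-1 * f)%g)).
  apply: uniq_leq_size; first by rewrite !filter_uniq.
  move=> g; rewrite mem_filter => /andP[/mapP[h hE ->] _].
  by apply/mapP; exists h; rewrite ?mulKg.
have lam0 i : 0 <= lam i.
  case: i => [_|f] /=; first by rewrite invr_ge0 ltW.
  by rewrite subr_ge0 ler_pdivrMr// mul1r ler_nat.
have tileF g : g \in J -> {subset tile g <= F}.
  by rewrite mem_filter => /andP[/allP gE _] _ /mapP[h hE ->]; apply: gE.
have cov j : j \in F -> \sum_(i <- r | j \in e i) lam i = 1.
  move=> jF; rewrite big_cat !big_map/=.
  rewrite -big_filter sumr_const_seq -/(n j).
  rewrite (eq_bigl (pred1 j)) => [|f]; last by rewrite inE eq_sym.
  by rewrite -big_filter filter_pred1_uniq// big_seq1 addrC subrK.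
have sub i : i \in r -> {subset e i <= F}.
  rewrite mem_cat => /orP[] /mapP[h hJ ->] /=; first exact: tileF.
  by move=> k; rewrite inE => /eqP->.
have ue i : uniq (e i) by case: i => //= g; rewrite uniq_translate.
have := lnW_fractional_cover B0 uB BA uF xA lam0 ue cov sub.
move=> /le_trans; apply; rewrite big_cat !big_map/=; apply: lerD.
  rewrite -sumr_const_seq; apply: ler_sum => g _.
  rewrite mulrC ler_wpM2r ?invr_ge0 ?(ltW cE)//.
  by apply: le_trans (lnW_translate g B0 BA uE xA) (WE _ (in_shift_act _ xA)).
apply: (@le_trans _ _ (\sum_(f <- F) lam (inr f) * z1)).
  by apply: ler_sum => f _; rewrite ler_wpM2l ?lnW_site//; apply: (lam0 (inr f)).
rewrite -mulr_suml le_eqVlt; apply/orP; left; apply/eqP; congr (_ * _).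
(* Double counting of the pairs of a tile and a site in it. *)
have sum_n : \sum_(f <- F) (n f)%:R = (size J)%:R * (size E)%:R :> R.
  under eq_bigr do rewrite -[(n _)%:R]mulr1 -sumr_const_seq big_filter.
  rewrite (exchange_big_dep xpredT)//= -sumr_const_seq.
  rewrite big_seq [RHS]big_seq; apply: eq_bigr => g gJ.
  rewrite -big_filter sumr_const_seq mulr1 -(size_map (fun e => (e * g)%g) E).
  congr _%:R; apply/perm_size/uniq_perm; rewrite ?filter_uniq ?uniq_translate//.
  by move=> f; rewrite mem_filter; apply: andb_idr; apply: tileF.
rewrite /lam sumrB sumr_const_seq mulr1 -mulr_suml sum_n.
by rewrite mulfK// gt_eqF.
Qed.

End Cover.

(** * Partition functions as suprema over finite sets of words *)

Local Notation shift_sup F w := (expeR (ereal_sup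
  [set (orbit_sum phi F y)%:E | y in cyl w `&` in_shift])).

(** The common form of both partition functions: it agrees with [Zpart_on] by unfolding when [A] is
    a finite set of letters, and with [Zpart] for the full alphabet by [ZpartE]. *)
Definition Zshift (F : {fset G}) : \bar R :=
  \esum_(w in [set w : {ffun F -> nat} | forall g, A (w g)]) shift_sup F w.

Lemma restr_eqP (F : {fset G}) x y :
  restr F y = restr F x <-> (forall g, g \in F -> y g = x g).
Proof.
split=> [yx g gF|yx]; last by apply/ffunP => -[g gF]; rewrite !ffunE; apply: yx.
by have := congr1 (fun w : {ffun F -> nat} => w (FSetSub gF)) yx; rewrite !ffunE.
Qed.

Lemma shift_supE (F : {fset G}) x : in_shift x ->
  shift_sup F (restr F x) = (expR (orb_sup F x))%:E.
Proof.
move=> xA; rewrite (_ : [set _ | y in _] = (EFin @` [set orb F y | y in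
    [set y | (forall g, g \in enum_fset F -> y g = x g) /\ in_shift y]])%classic).
  rewrite ereal_sup_EFin//; first exact: orb_set_ub.
  by exists (orb F x), x.
rewrite image_comp; congr image; apply/seteqP.
by split=> y [/restr_eqP yx yA].
Qed.

Lemma restr_words_inj B (F : {fset G}) x :
  {in words B F x &, injective (restr F)}.
Proof.
move=> y z yw zw /restr_eqP yz; apply/funext => g.
have [/yz//|gF] := boolP (g \in F).
by rewrite (words_restr (fset_uniq F) yw gF) (words_restr (fset_uniq F) zw gF).
Qed.

Lemma fsum_words B (F : {fset G}) x : uniq B -> (forall a, a \in B -> A a) ->
  in_shift x ->
  (\sum_(w \in [set` [seq restr F y | y <- words B F x]]) shift_sup F w)%R
  = (\sum_(y <- words B F x) expR (orb_sup F y))%:E.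
Proof.
move=> uB BA xA; rewrite -fsbig_seq; last first.
  by rewrite map_inj_in_uniq ?uniq_words//; apply: restr_words_inj.
rewrite big_map -sumEFin big_seq [RHS]big_seq; apply: eq_bigr => y yw.
by rewrite shift_supE//; apply: in_shift_words yw => //; apply: fset_uniq.
Qed.

Lemma Zshift_ge B (F : {fset G}) x : uniq B -> (forall a, a \in B -> A a) ->
  in_shift x ->
  ((\sum_(y <- words B F x) expR (orb_sup F y))%:E <= Zshift F)%E.
Proof.
move=> uB BA xA; apply: esum_ge.
exists [set` [seq restr F y | y <- words B F x]]; last by rewrite fsum_words.
split; first exact: finite_seq.
move=> _ /mapP[y yw ->] g /=; rewrite ffunE.
have yA : in_shift y := in_shift_words (fset_uniq F) BA xA yw.
exact: yA.
Qed.

Definition glue (F : {fset G}) (w : {ffun F -> nat}) x : config G :=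
  fun g => if insub g is Some h then w h else x g.

(** The sum is the supremum of its finite subsums, and finitely many words on [F] use finitely many
    letters; joined with [C], these form a finite alphabet [B]. The list [C] prescribes letters that
    [B] must contain. *)
Lemma Zshift_le (C : seq nat) (F : {fset G}) x (M : R) :
  (forall a, a \in C -> A a) -> in_shift x ->
  (forall B, uniq B -> {subset C <= B} -> (forall a, a \in B -> A a) ->
    \sum_(y <- words B F x) expR (orb_sup F y) <= M) ->
  (Zshift F <= M%:E)%E.
Proof.
move=> CA xA WM; apply: ge_ereal_sup => _ [X [finX XA] <-].
pose B := undup (C ++ flatten [seq [seq w g | g <- enum {: F}] |
  w : {ffun F -> nat} <- fset_set X]).
have BA a : a \in B -> A a.
  rewrite mem_undup mem_cat => /orP[/CA//|/flatten_mapP[w wX /mapP[g _ ->]]].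
  by apply: XA; rewrite -[X]fset_setK.
have CB : {subset C <= B} by move=> a aC; rewrite mem_undup mem_cat aC.
have uB : uniq B by exact: undup_uniq.
apply: le_trans (_ : (_ <= (\sum_(y <- words B F x) expR (orb_sup F y))%:E)%E) _;
  last by rewrite lee_fin WM.
rewrite -fsum_words//; apply: lee_fsum_nneg_subset => //.
- exact: finite_seq.
- move=> w; rewrite !inE => wX /=; apply/mapP; exists (glue w x); last first.
    by apply/ffunP => g; rewrite ffunE /glue valK.
  apply/(mem_words _ _ _ (fset_uniq F)); split => g gF; rewrite /glue; last first.
    by case: insubP => // h hF; rewrite hF in gF.
  case: insubP => [h _ _|]; last by rewrite gF.
  rewrite mem_undup mem_cat; apply/orP; right; apply/flatten_mapP.
  by exists w; [rewrite in_fset_set// inE|apply/mapP; exists h; rewrite ?mem_enum].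
- by move=> w _; apply: expeR_ge0.
Qed.

(** * Pressure over an alphabet *)

Section Pressure.
Implicit Types (E F : {fset G}).

Lemma size_centers_le E F : (size (tile_centers E F) <= #|` F|)%N.
Proof. by rewrite size_filter count_size. Qed.

(** A product [e * g] leaving [F] lies in the part [EF \ F] of the symmetric difference, whose size
    is bounded by invariance. *)
Lemma size_non_centers_invariant E F (d : R) : invariant_fset E d F ->
  (#|` F|)%:R - (size (tile_centers E F))%:R <= (#|` E|)%:R * (d * (#|` F|)%:R).
Proof.
move=> /ltW inv; rewrite -natrB ?size_centers_le//.
apply: le_trans (ler_wpM2l (ler0n _ _) inv); rewrite -natrM ler_nat.
apply: leq_trans (size_non_centers (D := fset_mulg E F `\` F) (fset_uniq F) _) _.
  move=> e g eE gF egF; rewrite in_fsetD egF; exact: in_imfset2.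
by rewrite leq_mul2l fsubset_leq_card ?orbT// fsubsetUl.
Qed.

Variable a0 : nat.
Hypotheses (Aa0 : A a0) (Z1oo : (Zshift [fset 1%g] < +oo)%E).

Let x0 : config G := fun=> a0.

Definition lnZ F := ln (fine (Zshift F)).

Lemma Zshift_gt0 F : (0 < Zshift F)%E.
Proof.
apply: lt_le_trans (@Zshift_ge [:: a0] F x0 _ _ _) => //.
  by rewrite lte_fin sum_expR_gt0// words_neq0.
by move=> a; rewrite inE => /eqP->.
Qed.

Lemma lnW_le_lnZ B F x : B != [::] -> uniq B -> (forall a, a \in B -> A a) ->
  in_shift x -> (Zshift F < +oo)%E -> lnW B F x <= lnZ F.
Proof.
move=> B0 uB BA xA Foo; have F0 := Zshift_gt0 F.
have Ffin : Zshift F \is a fin_num by rewrite ge0_fin_numE// ltW.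
rewrite ler_ln ?posrE ?sum_expR_gt0 ?words_neq0//; last by rewrite fine_gt0// F0.
by rewrite -lee_fin fineK// Zshift_ge.
Qed.

Lemma lnW_site_le_lnZ B y : B != [::] -> uniq B -> (forall a, a \in B -> A a) ->
  in_shift y -> lnW B [:: 1%g] y <= lnZ [fset 1%g].
Proof. by rewrite fset_seq1 => *; apply: lnW_le_lnZ. Qed.

Lemma Zshift_lnW_le (C : seq nat) F (M : R) : (forall a, a \in C -> A a) ->
  (forall B, B != [::] -> uniq B -> {subset C <= B} ->
    (forall a, a \in B -> A a) -> lnW B F x0 <= M) ->
  (Zshift F <= (expR M)%:E)%E.
Proof.
(* Prescribing [a0] in addition makes [B] nonempty. *)
move=> CA WM; apply: (@Zshift_le (a0 :: C) F x0) => // [a|B uB CB BA].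
  by rewrite inE => /orP[/eqP->|/CA].
have B0 : B != [::] by case: B CB {uB BA} => // /(_ a0); rewrite inE eqxx => /(_ isT).
rewrite -lseK// ler_expR WM// => a aC; apply: CB; by rewrite inE aC orbT.
Qed.

Lemma Zshift_ltoo F : (Zshift F < +oo)%E.
Proof.
apply: le_lt_trans (ltry (expR ((size F)%:R * lnZ [fset 1%g]))).
apply: (@Zshift_lnW_le [::]) => // B B0 uB _ BA.
apply: lnW_le_sites => // [|y yA]; first exact: fset_uniq.
exact: lnW_site_le_lnZ.
Qed.

Lemma Zshift_fin F : Zshift F \is a fin_num.
Proof. by rewrite ge0_fin_numE ?Zshift_ltoo// ltW// Zshift_gt0. Qed.

Lemma fine_Zshift_gt0 F : 0 < fine (Zshift F).
Proof. by rewrite fine_gt0// Zshift_gt0 Zshift_ltoo. Qed.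

Lemma lnZ_le (C : seq nat) F (M : R) : (forall a, a \in C -> A a) ->
  (forall B, B != [::] -> uniq B -> {subset C <= B} ->
    (forall a, a \in B -> A a) -> lnW B F x0 <= M) ->
  lnZ F <= M.
Proof.
move=> CA /(Zshift_lnW_le CA); rewrite -[Zshift F]fineK ?Zshift_fin// lee_fin.
by move=> ?; rewrite -[M]expRK ler_ln ?posrE ?expR_gt0// fine_Zshift_gt0.
Qed.

Lemma lnZ_le_tiles E F : E != fset0 ->
  lnZ F <= (size (tile_centers E F))%:R * (lnZ E / (#|` E|)%:R)
    + ((#|` F|)%:R - (size (tile_centers E F))%:R) * lnZ [fset 1%g].
Proof.
move=> E0; apply: (@lnZ_le [::]) => // B B0 uB _ BA.
apply: lnW_le_tiles => //; try exact: fset_uniq.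
- by move=> y yA; apply: lnW_le_lnZ => //; apply: Zshift_ltoo.
- by move=> y yA; apply: lnW_site_le_lnZ.
Qed.

(** The constant configuration [x0] is fixed by the action, and its word alone contributes at least
    the exponential of the left-hand side. This bounds the means from below, so their infimum is
    finite. *)
Lemma lnZ_ge F : (#|` F|)%:R * phi x0 <= lnZ F.
Proof.
apply: le_trans (@lnW_le_lnZ [:: a0] F x0 _ _ _ _ _) => //; last exact: Zshift_ltoo.
  have -> : (#|` F|)%:R * phi x0 = orb F x0 by rewrite -sumr_const_seq.
  rewrite -[orb _ _]expRK /lnW /lse ler_ln ?posrE ?expR_gt0 ?sum_expR_gt0 ?words_neq0//.
  have x0w : x0 \in words [:: a0] F x0.
    by apply/mem_words => //; split => // j _; rewrite inE.
  rewrite (perm_big _ (perm_to_rem x0w)) big_cons/=.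
  rewrite -[leLHS]addr0 lerD ?ler_expR ?le_orb_sup//.
  by apply: sumr_ge0 => *; apply: expR_ge0.
by move=> a; rewrite inE => /eqP->.
Qed.

Definition mean_lnZ F := lnZ F / (#|` F|)%:R.

Definition inf_mean_lnZ :=
  inf [set mean_lnZ E | E in [set E : {fset G} | E != fset0]].

Lemma cardfs_gt0R F : F != fset0 -> 0 < (#|` F|)%:R :> R.
Proof. by move=> F0; rewrite ltr0n cardfs_gt0. Qed.

Lemma mean_lnZ_lbound :
  has_lbound [set mean_lnZ E | E in [set E : {fset G} | E != fset0]].
Proof.
exists (phi x0) => _ [E /= /cardfs_gt0R E0 <-].
by rewrite /mean_lnZ ler_pdivlMr// mulrC lnZ_ge.
Qed.

Lemma mean_lnZ_nonempty :
  [set mean_lnZ E | E in [set E : {fset G} | E != fset0]] !=set0.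
Proof.
by exists (mean_lnZ [fset 1%g]), [fset 1%g] => //=; apply/fset0Pn; exists 1%g; rewrite inE.
Qed.

Lemma inf_mean_lnZ_le F : F != fset0 -> inf_mean_lnZ <= mean_lnZ F.
Proof. by move=> F0; apply: ge_inf; [exact: mean_lnZ_lbound|exists F]. Qed.

Lemma mean_log_Zshift F : mean_log F (Zshift F) = (mean_lnZ F)%:E.
Proof.
rewrite /mean_log -[Zshift F]fineK ?Zshift_fin// lne_EFin ?fine_Zshift_gt0//.
by rewrite -EFinM mulrC.
Qed.

(** Take [E] nearly attaining the infimum. When [F] is invariant enough, almost all its sites are
    centres and the tile bound brings its mean within [e] of the infimum; the infimum itself is the
    lower bound. *)
Lemma mean_lnZ_cvg : mean_lnZ F @[F --> folner R G] --> inf_mean_lnZ.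
Proof.
apply/cvgrPdist_lt => e e0; have e20 : 0 < e / 2 by rewrite divr_gt0.
have [_ [E /= E0 <-] Ee] := inf_adherent e20
  (conj mean_lnZ_nonempty mean_lnZ_lbound).
have cE := cardfs_gt0R E0.
pose b := `|lnZ [fset 1%g] - mean_lnZ E|.
have b0 : 0 <= b by exact: normr_ge0.
(* Chosen so that the boundary error [|E| d b |F|] is at most [e / 2] per site; [b + 1] keeps the
   divisor positive when [b = 0]. *)
pose d := e / 2 / ((#|` E|)%:R * (b + 1)).
have d0 : 0 < d by rewrite divr_gt0// mulr_gt0// ltr_wpDl.
exists (E, d) => //= F /= [F0 Finv]; have cF := cardfs_gt0R F0.
rewrite distrC ger0_norm ?subr_ge0 ?inf_mean_lnZ_le// ltrBlDl.
have := size_non_centers_invariant Finv.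
have := lnZ_le_tiles F E0; rewrite -/(mean_lnZ E).
set J := size _; set z1 := lnZ [fset 1%g]; set m := mean_lnZ E => lnF FJ.
have JF : 0 <= (#|` F|)%:R - J%:R :> R by rewrite subr_ge0 ler_nat size_centers_le.
have dE : (#|` E|)%:R * (d * (#|` F|)%:R) * b <= e / 2 * (#|` F|)%:R.
  rewrite (_ : _ * b = e / 2 * (b / (b + 1)) * (#|` F|)%:R); last first.
    by rewrite /d; field; rewrite !gt_eqF// ltr_wpDl.
  rewrite ler_wpM2r ?(ltW cF)// ler_piMr ?(ltW e20)//.
  by rewrite ler_pdivrMr ?ltr_wpDl// mul1r lerDl.
(* Regrouped, the tile bound reads [lnZ F <= m |F| + (|F| - J) (z1 - m)]. *)
have : ((#|` F|)%:R - J%:R) * (z1 - m) <= e / 2 * (#|` F|)%:R.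
  apply: le_trans dE; apply: le_trans (ler_wpM2l JF (ler_norm _)) _.
  exact: ler_wpM2r b0 _ _ FJ.
move=> main; rewrite /mean_lnZ ltr_pdivrMr//.
have : m * (#|` F|)%:R < (inf_mean_lnZ + e / 2) * (#|` F|)%:R by rewrite ltr_pM2r.
nra.
Qed.

End Pressure.

End Local.

(** * Restriction to a finite alphabet *)

Section FiniteAlphabet.
Variables (R : realType) (G : groupType) (phi : config G -> R) (O : R).
Hypothesis phiO : forall x y : config G, x 1%g = y 1%g -> `|phi x - phi y| <= O.

(** The logarithmic weight of the letter [a] in the one-site partition function. *)
Definition site_sup (a : nat) : R := orb_sup phi setT [:: 1%g] (fun=> a).

Lemma in_shiftT (x : config G) : in_shift setT x. Proof. by []. Qed.

Lemma orb1 (x : config G) : orb phi [:: 1%g] x = phi x.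
Proof. by rewrite /orb big_seq1 act1. Qed.

Lemma le_site_sup x : phi x <= site_sup (x 1%g).
Proof.
rewrite -[leLHS]orb1; apply: (le_orb_sup phiO) => // g.
by rewrite inE => /eqP->.
Qed.

Lemma site_sup_le x : site_sup (x 1%g) <= phi x + O.
Proof.
apply: orb_sup_le => // y _ yx; rewrite orb1 -lerBlDl.
by apply: le_trans (ler_norm _) _; apply: phiO; apply: yx; rewrite inE.
Qed.

Lemma osc_ge0 : 0 <= O.
Proof. exact: le_trans (@phiO (fun=> 0%N) (fun=> 0%N) erefl). Qed.

Lemma sum_words1 (B : seq nat) (x : config G) :
  \sum_(y <- words B [:: 1%g] x) expR (orb_sup phi setT [:: 1%g] y)
  = \sum_(a <- B) expR (site_sup a).
Proof.
rewrite /= big_flatten big_map; apply: eq_bigr => a _; rewrite big_seq1.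
congr expR; apply: orb_sup_depends_on => g; rewrite /= inE => /eqP->.
by rewrite /upd eqxx.
Qed.

(** If no finite alphabet containing 0 came within [eta] of the one-site sum [Z], all partial sums
    would stay at or below [Z - eta], and so would [Z]. The letter 0 is kept in [A] to serve as the
    replacement letter. *)
Lemma small_tail (eta : R) : 0 < eta -> (Zshift phi setT [fset 1%g] < +oo)%E ->
  exists A : {fset nat}, 0%N \in A /\ forall D : seq nat, uniq D ->
    {subset A <= D} -> \sum_(a <- D | a \notin A) expR (site_sup a) <= eta.
Proof.
move=> eta0 Zoo; pose Z := fine (Zshift phi setT [fset 1%g]).
have ZE : Zshift phi setT [fset 1%g] = Z%:E.
  by rewrite fineK// (Zshift_fin phiO (a0 := 0%N)).
have le_Z B : uniq B -> \sum_(a <- B) expR (site_sup a) <= Z.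
  move=> uB; rewrite -(sum_words1 B (fun=> 0%N)) fset_seq1 -lee_fin -ZE.
  exact: (Zshift_ge phiO).
have [[B [uB B0 BZ]]|noB] := pselect (exists B : seq nat,
    [/\ uniq B, 0%N \in B & Z - eta < \sum_(a <- B) expR (site_sup a)]).
  exists [fset a in B]; split=> [|D uD BD]; first by rewrite inE.
  have := le_Z _ uD; rewrite (bigID (mem B))/= -big_filter.
  rewrite (perm_big B); last first.
    apply: uniq_perm; rewrite ?filter_uniq// => a; rewrite mem_filter.
    by apply: andb_idr => aB; apply: BD; rewrite inE.
  under [in X in _ -> X]eq_bigl do rewrite inE.
  lra.
suff : (Zshift phi setT [fset 1%g] <= (Z - eta)%:E)%E.
  by rewrite ZE lee_fin => ?; exfalso; lra.
apply: (Zshift_le phiO (C := [:: 0%N]) (x := fun=> 0%N)) => // B uB CB _.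
rewrite -fset_seq1 sum_words1 leNgt; apply/negP => BZ; apply: noB; exists B.
by split => //; apply: CB; rewrite inE.
Qed.

(** * The cost of replacing letters *)

Section Compare.
Variables (A : {fset nat}) (a0 : nat) (E : {fset G}) (eps eta : R).
Hypotheses (a0A : a0 \in A).
Hypothesis phiE : forall x y : config G,
  (forall g, g \in E -> x g = y g) -> `|phi x - phi y| <= eps.

(** [c + site_sup a] is the total price of one replaced letter [a]: [site_sup a - site_sup a0 + O]
    at its own site, and [O] for each of the at most [|E|] sites whose window [E h] contains it. *)
Let c : R := O * (1 + (#|` E|)%:R) - site_sup a0.
Let rho := @retract G A a0.

Lemma retract_in_shift (y : config G) : in_shift [set` A] (rho y).
Proof. by move=> g /=; rewrite /rho /retract; case: ifP. Qed.

(** If the letter at [h] is replaced, both values are compared through [site_sup]. If it is kept,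
    the change is at most [O], charged to the boundary when the window [E h] leaves [F] and
    otherwise to a replaced letter in the window; if the window has none, the change is at most
    [eps]. *)
Lemma phi_retract_le (F : {fset G}) h (y : config G) : h \in F ->
  phi (act h y) <= phi (act h (rho y)) + eps
    + (if h \in tile_centers E F then 0 else O)
    + (if y h \in A then 0 else site_sup (y h) - site_sup a0 + O)
    + O * \sum_(e <- E)
        (if ((e * h)%g \in F) && (y (e * h)%g \notin A) then 1 else 0).
Proof.
move=> hF; set sE := \sum_(e <- E) _.
have sE0 : 0 <= sE by apply: sumr_ge0 => e _; case: ifP.
have O0 := osc_ge0; have OsE : 0 <= O * sE by rewrite mulr_ge0.
have eps0 : 0 <= eps by apply: le_trans (phiE (x := y) (y := y) _).
have [yA|yA] := boolP (y h \in A); last first.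
  have := le_site_sup (act h y); have := site_sup_le (act h (rho y)).
  rewrite /act mul1g {1}/rho /retract (negbTE yA) => s1 s2.
  by case: ifP => _; lra.
have diffO : phi (act h y) <= phi (act h (rho y)) + O.
  rewrite -lerBlDl; apply: le_trans (ler_norm _) _; apply: phiO.
  by rewrite /act mul1g /rho /retract yA.
case: ifPn => hJ; last by lra.
have [bad|good] := boolP (has (fun e => y (e * h)%g \notin A) E).
  have [e eE ye] := hasP bad.
  have : 1 <= sE.
    rewrite /sE (perm_big _ (perm_to_rem eE)) big_cons/= ye.
    move: hJ; rewrite mem_filter => /andP[/allP /(_ e eE) -> _].
    by rewrite lerDl sumr_ge0// => i _; case: ifP.
  by move/(ler_wpM2l O0); lra.
suff : phi (act h y) <= phi (act h (rho y)) + eps by lra.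
rewrite -lerBlDl; apply: le_trans (ler_norm _) _; apply: phiE => e eE.
by move/hasPn: good => /(_ e eE); rewrite negbK /act /rho /retract => ->.
Qed.

(** Sum over [h] in [F]. For fixed [e], distinct [h] give distinct sites [e * h], so each replaced
    letter is charged at most once per element of [E]. *)
Lemma orb_retract_le (F : {fset G}) (y : config G) :
  orb phi F y <= orb phi F (rho y) + (#|` F|)%:R * eps
    + ((#|` F|)%:R - (size (tile_centers E F))%:R) * O
    + \sum_(g <- F | y g \notin A) (c + site_sup (y g)).
Proof.
pose bad e h := ((e * h)%g \in F) && (y (e * h)%g \notin A).
pose nb := size [seq g <- F | y g \notin A].
have bad_le e : \sum_(h <- F) (if bad e h then 1 else 0) <= nb%:R :> R.
  rewrite -big_mkcond -big_filter sumr_const_seq mulr1 ler_nat.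
  rewrite -(size_map (fun h => (e * h)%g)); apply: uniq_leq_size.
    by rewrite map_inj_uniq ?filter_uniq//; apply: mulgI.
  by move=> g /mapP[h]; rewrite mem_filter => /andP[/andP[gF yg] _] ->;
    rewrite mem_filter yg.
have badE : \sum_(h <- F) O * \sum_(e <- E) (if bad e h then 1 else 0)
    <= nb%:R * (O * (#|` E|)%:R).
  rewrite -mulr_sumr mulrCA ler_wpM2l ?osc_ge0// exchange_big/=.
  by rewrite mulrC -sumr_const_seq ler_sum.
have badA : \sum_(h <- F) (if y h \in A then 0 else site_sup (y h) - site_sup a0 + O)
    + nb%:R * (O * (#|` E|)%:R) = \sum_(g <- F | y g \notin A) (c + site_sup (y g)).
  rewrite -sumr_const_seq big_filter [RHS]big_mkcond [X in _ + X]big_mkcond.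
  rewrite -big_split; apply: eq_bigr => g _ /=.
  by case: (y g \in A) => /=; rewrite ?addr0// /c; ring.
have outJ : \sum_(h <- F) (if h \in tile_centers E F then 0 else O)
    = ((#|` F|)%:R - (size (tile_centers E F))%:R) * O.
  rewrite (eq_bigr (fun h => O - if h \in tile_centers E F then O else 0)).
    rewrite sumrB sumr_const_seq mulrBl -big_mkcond -big_filter sumr_const_seq.
    congr (_ - _%:R * _); congr size; apply: eq_in_filter => g gF.
    by rewrite mem_filter gF andbT.
  by move=> h _; case: ifP => _; rewrite ?subrr ?subr0.
have : orb phi F y <= \sum_(h <- F) (phi (act h (rho y)) + eps
    + (if h \in tile_centers E F then 0 else O)
    + (if y h \in A then 0 else site_sup (y h) - site_sup a0 + O)
    + O * \sum_(e <- E) (if bad e h then 1 else 0)).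
  rewrite /orb big_seq [leRHS]big_seq; apply: ler_sum => h hF.
  exact: phi_retract_le.
rewrite -badA !big_split/= -/(orb phi F (rho y)) outJ sumr_const_seq.
by move=> /le_trans; apply; rewrite -addrA lerD2l lerD2l.
Qed.

Hypothesis tail : forall D : seq nat, uniq D -> {subset A <= D} ->
  \sum_(a <- D | a \notin A) expR (c + site_sup a) <= eta.

Let x0 : config G := fun=> a0.

(** Words over [D] are sent to their retracts. The price of the replaced letters factors over the
    sites into the weights [t], and summing these out costs [(1 + eta) ^ |F| <= exp (eta |F|)]. *)
Lemma lnW_retract_le (D : seq nat) (F : {fset G}) : uniq D -> {subset A <= D} ->
  lnW phi setT D F x0 <= lnW phi [set` A] A F x0 + (#|` F|)%:R * (eps + eta)
    + ((#|` F|)%:R - (size (tile_centers E F))%:R) * O.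
Proof.
move=> uD AD.
have A0 : enum_fset A != [::] by have : a0 \in enum_fset A by []; case: (enum_fset A).
have D0 : D != [::] by apply: contraTneq (AD _ a0A) => ->.
have eta0 : 0 <= eta.
  by apply: le_trans (tail uD AD); apply: sumr_ge0 => *; apply: expR_ge0.
(* [k] collects the errors that do not depend on the word. *)
pose k := (#|` F|)%:R * eps + ((#|` F|)%:R - (size (tile_centers E F))%:R) * O.
pose t a : R := if a \in A then 1 else expR (c + site_sup a).
rewrite -ler_expR !lseK//.
apply: (@le_trans _ _ (\sum_(y <- words D F x0) expR k *
    (expR (orb_sup phi [set` A] F (rho y)) * \prod_(g <- F) t (y g)))).
  apply: ler_sum => y _.
  have -> : \prod_(g <- F) t (y g)
      = expR (\sum_(g <- F | y g \notin A) (c + site_sup (y g))).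
    rewrite expR_sum [RHS]big_mkcond; apply: eq_bigr => g _.
    by rewrite /t; case: (y g \in A).
  (* The bound is applied to each [z] that agrees with [y] on [F]; the price only reads letters at
     sites of [F], so it is the same for both. *)
  rewrite -!expRD ler_expR; apply: orb_sup_le => // z _ zy.
  apply: le_trans (orb_retract_le F z) _.
  have -> : \sum_(g <- F | z g \notin A) (c + site_sup (z g))
      = \sum_(g <- F | y g \notin A) (c + site_sup (y g)).
    rewrite big_seq_cond [RHS]big_seq_cond; apply: eq_big => [g|g /andP[gF _]].
      by case: (boolP (g \in F)) => //= gF; rewrite zy.
    by rewrite zy.
  have : orb phi F (rho z) <= orb_sup phi [set` A] F (rho y).
    apply: (le_orb_sup phiO); first exact: retract_in_shift.
    by move=> g gF; rewrite /rho /retract zy.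
  by rewrite /k; lra.
rewrite -mulr_sumr.
have t0 a : 0 <= t a by rewrite /t; case: ifP => // _; apply: expR_ge0.
have t1 a : a \in A -> t a = 1 by rewrite /t => ->.
have tD : \sum_(a <- D | a \notin A) t a <= eta.
  rewrite (eq_bigr (fun a => expR (c + site_sup a))); first exact: tail.
  by rewrite /t => a /negbTE ->.
have := sum_words_retract_le (V := fun y => expR (orb_sup phi [set` A] F y)) x0
  (fset_uniq A) uD AD a0A (fset_uniq F) t0 t1 tD (fun=> expR_ge0 _).
have -> : retract A a0 x0 = x0 by apply/funext => g; rewrite /retract /x0; case: ifP.
move=> /(ler_wpM2l (expR_ge0 k)) /le_trans; apply.
set W := lnW _ _ _ _ _.
rewrite [leRHS](_ : _ = expR k * (expR ((#|` F|)%:R * eta) * expR W)); last first.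
  by rewrite -!expRD; congr expR; rewrite /k; ring.
rewrite ler_wpM2l ?expR_ge0// /W lseK// ler_wpM2r//.
  by apply: sumr_ge0 => *; apply: expR_ge0.
by rewrite mulrC expRM_natr lerXn2r ?nnegrE ?expR_ge0 ?addr_ge0// expR_ge1Dx.
Qed.

End Compare.
End FiniteAlphabet.

(** * Finite alphabets against the full alphabet *)

Section FixedOscillation.
Variables (R : realType) (G : groupType) (phi : config G -> R) (O : R).
Hypothesis phiO : forall x y : config G, x 1%g = y 1%g -> `|phi x - phi y| <= O.
Hypothesis Zoo : (Zshift phi setT [fset 1%g] < +oo)%E.
Hypothesis amG : amenable R G.

(** Passing to [A] leaves fewer words, and suprema over fewer configurations. *)
Lemma Zshift_mono (A : {fset nat}) (F : {fset G}) : A != fset0 ->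
  (Zshift phi [set` A] F <= Zshift phi setT F)%E.
Proof.
case/fset0Pn => a0 a0A; have x0A : in_shift [set` A] (fun _ : G => a0) by [].
have Ffin : Zshift phi setT F \is a fin_num by rewrite (Zshift_fin phiO (a0 := a0)).
rewrite -(fineK Ffin); apply: (Zshift_le phiO (C := [::]) _ x0A) => // B uB _ BA.
have := @Zshift_ge _ _ phi setT _ phiO B F (fun=> a0) uB (fun _ _ => I) (in_shiftT _).
rewrite -(fineK Ffin) lee_fin; apply: le_trans.
rewrite big_seq [leRHS]big_seq; apply: ler_sum => y yw; rewrite ler_expR.
apply: orb_sup_le; first exact: in_shift_words (fset_uniq F) BA x0A yw.
by move=> z _ zy; apply: (le_orb_sup phiO).
Qed.

Lemma Zshift_on_ltoo (A : {fset nat}) : A != fset0 ->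
  (Zshift phi [set` A] [fset 1%g] < +oo)%E.
Proof. by move=> A0; apply: le_lt_trans Zoo; apply: Zshift_mono. Qed.

Lemma mean_log_cvg (A : set nat) (a0 : nat) : A a0 ->
  (Zshift phi A [fset 1%g] < +oo)%E ->
  mean_log F (Zshift phi A F) @[F --> folner R G] --> (inf_mean_lnZ phi A)%:E.
Proof.
move=> Aa0 Aoo.
rewrite (_ : (fun F => _) = EFin \o mean_lnZ phi A); last first.
  by apply/funext => F; rewrite (mean_log_Zshift phiO Aa0).
apply: cvg_EFin; last first.
  by move: (mean_lnZ_cvg phiO Aa0 Aoo).
exact: nearW.
Qed.

Lemma inf_mean_lnZ_mono (A : {fset nat}) : A != fset0 ->
  inf_mean_lnZ phi [set` A] <= inf_mean_lnZ phi setT.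
Proof.
move=> A0; have /fset0Pn[a0 a0A] := A0; have Aoo := Zshift_on_ltoo A0.
apply: lb_le_inf; first exact: mean_lnZ_nonempty.
move=> _ [E /= E0 <-].
apply: le_trans (inf_mean_lnZ_le phiO (A := [set` A]) a0A Aoo E0) _.
rewrite ler_wpM2r ?invr_ge0 ?ler0n// ler_ln ?posrE.
- by apply: fine_le; rewrite ?Zshift_mono// (Zshift_fin phiO (a0 := a0)).
- exact: (fine_Zshift_gt0 phiO (A := [set` A]) a0A Aoo).
- exact: (fine_Zshift_gt0 phiO (A := setT) (a0 := a0) I Zoo).
Qed.

(** At a single sufficiently invariant [F], provided by amenability, four errors of [e / 4] per site
    add up: uniform continuity, the tail of the alphabet, the boundary of [F], and the distance of
    the mean over [A] from its limit. *)
Lemma inf_mean_lnZ_approx (e : R) : uniformly_continuous phi -> 0 < e ->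
  exists2 A : {fset nat}, A != fset0 &
    inf_mean_lnZ phi setT <= inf_mean_lnZ phi [set` A] + e.
Proof.
move=> ucphi e0; have PF : ProperFilter (folner R G) by exact: folner_proper.
have e40 : 0 < e / 4 by rewrite divr_gt0.
have O0 := osc_ge0 phiO.
(* The identity is adjoined to make [E] nonempty. *)
have [E0 oscE] := ucphi _ e40; pose E := 1%g |` E0.
have En0 : E != fset0 by apply/fset0Pn; exists 1%g; rewrite !inE eqxx.
have phiE (x y : config G) : (forall g, g \in E -> x g = y g) ->
    `|phi x - phi y| <= e / 4.
  move=> xy; rewrite -lee_fin; apply: le_trans (ltW oscE).
  apply: ereal_sup_ubound; exists x, y; split=> // g gE.
  by apply: xy; rewrite inE; apply/orP; right.
pose c := O * (1 + (#|` E|)%:R) - site_sup phi 0%N.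
(* The letter prices carry the factor [expR c]; a tail this small stays below [e / 4] after
   multiplication by it. *)
have eta0 : 0 < e / 4 / expR c by rewrite divr_gt0 ?expR_gt0.
have [A [A0 tailA]] := small_tail phiO eta0 Zoo.
have An0 : A != fset0 by apply/fset0Pn; exists 0%N.
exists A => //; have Aoo := Zshift_on_ltoo An0.
have tail (D : seq nat) : uniq D -> {subset A <= D} ->
    \sum_(a <- D | a \notin A) expR (c + site_sup phi a) <= e / 4.
  move=> uD AD; under eq_bigr do rewrite expRD.
  by rewrite -mulr_sumr mulrC -ler_pdivlMr ?expR_gt0// tailA.
have cE := cardfs_gt0R R En0.
(* Chosen so that the boundary term [|E| d O |F|] is at most [e / 4] per site; [O + 1] covers the
   case [O = 0]. *)
pose d := e / 4 / ((#|` E|)%:R * (O + 1)).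
have d0 : 0 < d by rewrite divr_gt0// mulr_gt0// ltr_wpDl.
have nearE : folner R G [set F | F != fset0 /\ invariant_fset E d F].
  by exists (E, d).
have /cvgrPdist_lt/(_ _ e40) := mean_lnZ_cvg phiO (A := [set` A]) A0 Aoo.
move=> /(filterI nearE)/filter_ex[F [[F0 Finv] /= qF]].
have cF := cardfs_gt0R R F0.
have {}qF : mean_lnZ phi [set` A] F < inf_mean_lnZ phi [set` A] + e / 4.
  by move: qF; rewrite distrC => /(le_lt_trans (ler_norm _)); rewrite ltrBlDl.
have IT (a : nat) : setT a by [].
apply: le_trans (inf_mean_lnZ_le phiO (IT 0%N) Zoo F0) _.
rewrite /mean_lnZ ler_pdivrMr//.
have lnZT : lnZ phi setT F <= lnZ phi [set` A] F + (#|` F|)%:R * (e / 4 + e / 4)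
    + ((#|` F|)%:R - (size (tile_centers E F))%:R) * O.
  apply: (lnZ_le phiO (IT 0%N) Zoo (C := A)) => // B B0 uB AB _.
  apply: le_trans (lnW_retract_le phiO A0 phiE tail F uB AB) _.
  rewrite !lerD2r; apply: (lnW_le_lnZ phiO (A := [set` A]) (a0 := 0%N)) => //.
    exact: fset_uniq.
  exact: (Zshift_ltoo phiO (A := [set` A]) A0 Aoo).
have FJ := size_non_centers_invariant Finv.
have dE : (#|` E|)%:R * (d * (#|` F|)%:R) * O <= e / 4 * (#|` F|)%:R.
  rewrite (_ : _ * O = e / 4 * (O / (O + 1)) * (#|` F|)%:R); last first.
    by rewrite /d; field; rewrite !gt_eqF// ltr_wpDl.
  rewrite ler_wpM2r ?(ltW cF)// ler_piMr ?(ltW e40)//.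
  by rewrite ler_pdivrMr ?ltr_wpDl// mul1r lerDl.
have := ler_wpM2r O0 FJ.
have : lnZ phi [set` A] F < (inf_mean_lnZ phi [set` A] + e / 4) * (#|` F|)%:R.
  by rewrite -ltr_pdivrMr.
lra.
Qed.

End FixedOscillation.

(** * The partition functions and pressures of the statement *)

Lemma ZpartE (R : realType) (G : groupType) (phi : config G -> R) F :
  Zpart phi F = Zshift phi setT F.
Proof.
rewrite /Zpart /Zshift (_ : [set w | _] = setT); last first.
  by apply/seteqP; split.
rewrite (_ : in_shift setT = setT); last by apply/seteqP; split.
by apply: eq_esum => w _; rewrite setIT.
Qed.

Theorem theorem3p8 (R : realType) (G : groupType) (phi : (G -> nat) -> R) :
  countable [set: G] ->
  amenable R G ->
  exp_summable phi ->
  uniformly_continuous phi ->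
  finite_oscillation phi ->
  exists p : R,
    [/\ mean_log F (Zpart phi F) @[F --> folner R G] --> p%:E,
        pressure phi = p%:E,
        pressure phi =
          ereal_inf [set mean_log E (Zpart phi E) | E in
            [set E : {fset G} | E != fset0]]
      & pressure phi =
          ereal_sup [set pressure_on A phi | A in
            [set A : {fset nat} | A != fset0]]].
Proof.
move=> _ amG Zoo ucphi oscoo; have PF := folner_proper amG.
have ge_osc (x y : config G) : x 1%g = y 1%g ->
    ((`|phi x - phi y|)%:E <= osc [set 1%g] phi)%E.
  by move=> xy; apply: ereal_sup_ubound; exists x, y; split=> // _ ->.
have osc_fin : osc [set 1%g] phi \is a fin_num.
  rewrite ge0_fin_numE//; apply: le_trans (ge_osc (fun=> 0%N) (fun=> 0%N) erefl).
  by rewrite lee_fin.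
have phiO (x y : config G) : x 1%g = y 1%g ->
    `|phi x - phi y| <= fine (osc [set 1%g] phi).
  by move=> /ge_osc; rewrite -{1}(fineK osc_fin) lee_fin.
have ZE : Zpart phi = Zshift phi setT by apply/funext => F; apply: ZpartE.
rewrite /exp_summable ZE in Zoo.
have IT : setT 0%N by [].
have cvgT := mean_log_cvg phiO IT Zoo.
have pE : pressure phi = (inf_mean_lnZ phi setT)%:E.
  by rewrite /pressure ZE; apply: cvg_lim cvgT.
have pAE A : A != fset0 -> pressure_on A phi = (inf_mean_lnZ phi [set` A])%:E.
  move=> A0; have /fset0Pn[a0 a0A] := A0.
  exact: cvg_lim (mean_log_cvg phiO a0A (Zshift_on_ltoo phiO Zoo A0)).
exists (inf_mean_lnZ phi setT); split => //; first by rewrite ZE.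
  rewrite pE ZE /inf_mean_lnZ -ereal_inf_EFin; last exact: mean_lnZ_nonempty.
    rewrite image_comp; congr ereal_inf; apply: eq_imagel => E _ /=.
    by rewrite (mean_log_Zshift phiO IT).
  by move: (mean_lnZ_lbound phiO IT Zoo).
(* Monotonicity in the alphabet bounds the supremum from above; the approximation by finite
   alphabets up to every [e] gives the converse. *)
rewrite pE; apply/eqP; rewrite eq_le; apply/andP; split; last first.
  apply: ge_ereal_sup => _ [A /= A0 <-].
  by rewrite pAE// lee_fin (inf_mean_lnZ_mono phiO).
apply/lee_addgt0Pr => e e0.
have [A A0 pA] := inf_mean_lnZ_approx phiO Zoo amG ucphi e0.
apply: le_trans (_ : _ <= pressure_on A phi + e%:E)%E _.
  by rewrite pAE// -EFinD lee_fin.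
by rewrite leeD2r//; apply: ereal_sup_ubound; exists A.
Qed.
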